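(* Let $q=2^h$ be even, $t\ge 3$ a prime, $q\ge t$. In $\mathrm{PG}(2,q^t)$, let $\mathcal C$ be a conic with nucleus $N$ and tangent to the line $\ell_\infty$ at the point $T$, and let $\mathcal D$ be an André set of $\ell_\infty$ with transversal points $T,N$. For $m\in\{1,\ldots,t-1\}$ perform an André replacement using the André replacement net $\mathcal D^m$, and let $\mathcal D_m(\mathcal C)$ denote the set of points in the André plane $\mathcal P(\mathcal D^m)$ corresponding to the affine points of $\mathcal C$. 1. If $h\equiv 0\pmod t$, then for each $m\in\{1,\ldots,t-1\}$, $\mathcal D_m(\mathcal C)$ is an arc which can be completed to an oval in the André plane $\mathcal P(\mathcal D^m)$. 2. If $h\not\equiv 0\pmod t$, then there is a unique $n\in\{1,\ldots,t-1\}$ for which $\mathcal D_n(\mathcal C)$ is not an arc in the André plane $\mathcal P(\mathcal D^n)$; for the remaining $t-2$ values $m\in\{1,\ldots,t-1\}\setminus\{n\}$, $\mathcal D_m(\mathcal C)$ is an arc which can be completed to an oval in the André plane $\mathcal P(\mathcal D^m)$.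
   Context: Conics are non-degenerate. As $q$ is even, all tangent lines of a conic pass through a common point, its nucleus. Homogeneous coordinates of $\mathrm{PG}(2,q^t)$ are $(x,y,z)$, with $\ell_\infty$ the line $z=0$; the point $(x,y,0)$ of $\ell_\infty\cong\mathrm{PG}(1,q^t)$ is also written $(x,y)$. Affine points are the points not on $\ell_\infty$; $(x,y,1)$ is identified with the vector $(x,y)\in V=\mathbb F_{q^t}^2$. An arc of a projective plane is a set of points, no three collinear; an oval of a projective plane of order $q^t$ is an arc of size $q^t+1$. Norm: $\mathrm N(k)=k^{1+q+\cdots+q^{t-1}}$ for $k\in\mathbb F_{q^t}$. André sets: for distinct points $E,F$ of $\mathrm{PG}(1,q^t)$, let $G\le \mathrm{PGL}(2,q^t)$ be the group (cyclic of order $q^t-1$) of projectivities fixing both $E$ and $F$, and $H$ its unique subgroup of order $q^{t-1}+\cdots+q+1$. The $q-1$ orbits of $H$ on $\mathrm{PG}(1,q^t)\setminus\{E,F\}$ are the André sets with transversal points $E,F$. The André sets with transversal points $(1,0),(0,1)$ are $\mathcal A_\delta=\{(1,\theta)\mid \theta\in\mathbb F_{q^t}^*,\ \mathrm N(\theta)=\delta\}$, $\delta\in\mathbb F_q^*$, and every André set is the image of such a set under a projectivity. Bruck–Bose representation: regard $V$ as a $2t$-dimensional $\mathbb F_q$-space, so affine points of $\mathrm{PG}(2,q^t)$ are the points of $\mathrm{AG}(2t,q)$. A point $P=(x,y)$ of $\ell_\infty$ corresponds to the $t$-dimensional $\mathbb F_q$-subspace $[P]=\{(sx,sy)\mid s\in\mathbb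 F_{q^t}\}$ of $V$ (projectively a $(t-1)$-space of the hyperplane at infinity $\mathrm{PG}(2t-1,q)$); the affine lines through $P$ are the cosets of $[P]$. André replacement nets: for $\mathcal D=\mathcal A_\delta$ and $m\in\{1,\ldots,t-1\}$, $\mathcal D^m=\{X_{m,u}\mid u\in\mathbb F_{q^t}^*,\mathrm N(u)=\delta\}$ where $X_{m,u}=\{(s,s^{q^m}u)\mid s\in\mathbb F_{q^t}\}$, a $t$-dimensional $\mathbb F_q$-subspace of $V$. For a general André set $\mathcal D$, choose $\varphi\in\mathrm{GL}(2,q^t)$ inducing a projectivity mapping some $\mathcal A_\delta$ to $\mathcal D$; the $t-1$ replacement nets of $\mathcal D$ are $\mathcal D^m=\{\varphi(X_{m,u})\}$, the images of those of $\mathcal A_\delta$ (the choice of $\varphi$ is fixed once and for all, and only affects the indexing of the $t-1$ nets). André replacement: a $\mathcal D^m$-block is a coset in $V$ of a member of $\mathcal D^m$. The incidence structure whose points are the affine points of $\mathrm{PG}(2,q^t)$ and whose lines are the affine lines of $\mathrm{PG}(2,q^t)$ meeting $\ell_\infty$ in a point not in $\mathcal D$, together with the $\mathcal D^m$-blocks, is an affine plane of order $q^t$; its projective completion is the André plane $\mathcal P(\mathcal D^m)$. *)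

(* Defs.v *)
From HB Require Import structures.
From mathcomp Require Import all_boot all_fingroup all_algebra.

Set Implicit Arguments.
Unset Strict Implicit.
Unset Printing Implicit Defensive.

Import GRing.Theory.
Local Open Scope ring_scope.

(** ** Projective spaces over a finite field *)

Definition is_point (F : finFieldType) (n : nat) (U : {set 'rV[F]_n}) : bool :=
  [exists v : 'rV[F]_n, (v != 0) && (U == [set a *: v | a : F])].

(** The points of PG(n, F) are the one-dimensional subspaces of F^(n+1), kept
    as sets of row vectors: [v \in P] says that [v] is zero or a vector of
    homogeneous coordinates of [P].  For n = 1 the underlying set of [P] is the
    subspace [P] of V = F^2 of the Bruck-Bose representation. *)
Record PG (F : finFieldType) (n : nat) := MkPG {
  PG_set :> {set 'rV[F]_n.+1};
  PG_setP : is_point PG_set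
}.

HB.instance Definition _ (F : finFieldType) (n : nat) :=
  [isSub for @PG_set F n].
HB.instance Definition _ (F : finFieldType) (n : nat) :=
  [Countable of PG F n by <:].
HB.instance Definition _ (F : finFieldType) (n : nat) :=
  [Finite of PG F n by <:].

(** Matrices act on row vectors on the right. *)
Definition mximage (F : finFieldType) (m n : nat) (A : 'M[F]_(m, n))
    (U : {set 'rV[F]_m}) : {set 'rV[F]_n} :=
  [set v *m A | v in U].

Definition induces (F : finFieldType) (n : nat) (A : 'M[F]_n.+1)
    (s : {perm PG F n}) : bool :=
  [forall P : PG F n, s P == mximage A P :> {set _}].

Definition projectivities (F : finFieldType) (n : nat) : {set {perm PG F n}} :=
  [set s : {perm PG F n} |
    [exists A : 'M[F]_n.+1, (A \in unitmx) && induces A s]].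

(** ** The plane PG(2, F) and its line at infinity z = 0 *)

Definition is_line (F : finFieldType) (L : {set PG F 2}) : Prop :=
  exists2 w : 'cV[F]_3, w != 0 &
    L = [set P : PG F 2 | [forall v in PG_set P, v *m w == 0]].

Definition line_at_infinity (F : finFieldType) : {set PG F 2} :=
  [set P : PG F 2 | [forall v in PG_set P, v 0 ord_max == 0]].

Lemma is_point_infty (F : finFieldType) (P : PG F 1) :
  is_point [set (row_mx v 0 : 'rV[F]_(2 + 1)) | v in PG_set P].
Proof.
case: P => U /= /existsP[v /andP[v0 /eqP->]].
apply/existsP; exists (row_mx v 0); apply/andP; split.
  by rewrite row_mx_eq0 negb_and v0.
apply/eqP/setP => w; apply/imsetP/imsetP.
  by case=> _ /imsetP[a _ ->] ->; exists a => //; rewrite scale_row_mx scaler0.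
case=> a _ ->; exists (a *: v); first exact: imset_f.
by rewrite scale_row_mx scaler0.
Qed.

(** The identification of PG(1, F) with the line at infinity,
    (x, y) |-> (x, y, 0). *)
Definition infty (F : finFieldType) (P : PG F 1) : PG F 2 :=
  MkPG (is_point_infty P).

(** ** Conics *)

(** Every quadratic form is [v |-> v A v^T] for some matrix [A], in every
    characteristic; [A] need not be symmetric, and it is not unique. *)
Definition qform (F : finFieldType) (A : 'M[F]_3) (v : 'rV[F]_3) : F :=
  (v *m A *m v^T) 0 0.

Definition polar (F : finFieldType) (A : 'M[F]_3) (v w : 'rV[F]_3) : F :=
  qform A (v + w) - qform A v - qform A w.

(** In characteristic 2 the polar form is alternating on F^3, hence always
    degenerate; nondegeneracy asks that the quadratic form have no nonzero zero
    in the radical of the polar form. *)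
Definition nondegenerate (F : finFieldType) (A : 'M[F]_3) : Prop :=
  forall v : 'rV[F]_3,
    qform A v = 0 -> (forall w : 'rV[F]_3, polar A v w = 0) -> v = 0.

Definition is_conic (F : finFieldType) (C : {set PG F 2}) : Prop :=
  exists2 A : 'M[F]_3, nondegenerate A &
    C = [set P : PG F 2 | [forall v in PG_set P, qform A v == 0]].

Definition tangent_at (F : finFieldType) (C L : {set PG F 2}) (P : PG F 2)
    : Prop :=
  is_line L /\ C :&: L = [set P].

Definition is_nucleus (F : finFieldType) (C : {set PG F 2}) (N : PG F 2)
    : Prop :=
  forall (L : {set PG F 2}) (P : PG F 2), tangent_at C L P -> N \in L.

(** The affine point (x, y, 1) is identified with the vector (x, y). *)
Definition affine_part (F : finFieldType) (C : {set PG F 2})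
    : {set 'rV[F]_2} :=
  [set v : 'rV[F]_2 |
    [exists P in C, (row_mx v 1 : 'rV[F]_(2 + 1)) \in PG_set P]].

(** ** Andre sets

    In what follows F has q ^ t elements. *)

Definition norm (F : finFieldType) (q t : nat) (k : F) : F :=
  k ^+ (\sum_(i < t) q ^ i)%N.

Definition fixing_group (F : finFieldType) (E1 E2 : PG F 1)
    : {set {perm PG F 1}} :=
  [set s in projectivities F 1 | (s E1 == E1) && (s E2 == E2)].

(** [fixing_group E1 E2] is cyclic, so that the subgroup [H] below is
    unique. *)
Definition is_Andre_set (F : finFieldType) (q t : nat) (E1 E2 : PG F 1)
    (D : {set PG F 1}) : Prop :=
  E1 != E2 /\
  exists H : {group {perm PG F 1}},
    [/\ H \subset fixing_group E1 E2,
        #|H| = (\sum_(i < t) q ^ i)%N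
      & exists2 P : PG F 1, P \notin [set E1; E2] & D = orbit 'P%act H P].

Definition vec2 (F : finFieldType) (x y : F) : 'rV[F]_2 :=
  \row_(j < 2) [:: x; y]`_j.

Definition std_Andre_set (F : finFieldType) (q t : nat) (delta : F)
    : {set PG F 1} :=
  [set P : PG F 1 | [exists theta : F,
    [&& theta != 0, norm q t theta == delta & vec2 1 theta \in PG_set P]]].

(** ** Andre replacement *)

Definition Xblock (F : finFieldType) (q m : nat) (u : F) : {set 'rV[F]_2} :=
  [set vec2 s (s ^+ (q ^ m) * u) | s : F].

(** The [m]-th replacement net of the image under [phi] of the Andre set
    [std_Andre_set q t delta]. *)
Definition replacement_net (F : finFieldType) (q t : nat) (phi : 'M[F]_2)
    (delta : F) (m : nat) : {set {set 'rV[F]_2}} :=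
  [set mximage phi (Xblock q m u) | u : F
    & (u != 0) && (norm q t u == delta)].

Definition translate (V : finZmodType) (a : V) (U : {set V}) : {set V} :=
  [set a + u | u in U].

(** The lines of the affine Andre plane; the affine lines of PG(2, F) through a
    point P at infinity are the translates of the set underlying P. *)
Definition Andre_lines (F : finFieldType) (D : {set PG F 1})
    (net : {set {set 'rV[F]_2}}) : {set {set 'rV[F]_2}} :=
  [set translate a (PG_set P) | a in [set: 'rV[F]_2], P in ~: D]
  :|: [set translate a U | a in [set: 'rV[F]_2], U in net].

(** ** Projective completion, arcs and ovals *)

Record plane (T : finType) := MkPlane {
  points : {set T};
  lines : {set {set T}}
}.

Definition parallel_class (V : finType) (B : {set {set V}}) (l : {set V})
    : {set {set V}} :=
  [set k in B | (k == l) || [disjoint k & l]].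

(** The points of the completion of the affine plane with point set [V] and
    line set [B] are the points of [V], injected by [inl], and the parallel
    classes of lines, injected by [inr]; the other elements of the carrier
    [V + {set {set V}}] are not points of the plane. *)
Definition completion (V : finType) (B : {set {set V}})
    : plane (V + {set {set V}})%type :=
  let infinite := [set inr (parallel_class B l) | l in B] in
  MkPlane ([set inl v | v : V] :|: infinite)
    (infinite |: [set inr (parallel_class B l) |: [set inl v | v in l]
                   | l in B]).

Definition is_arc (T : finType) (Pi : plane T) (K : {set T}) : Prop :=
  K \subset points Pi /\
  forall a b c : T, a \in K -> b \in K -> c \in K -> uniq [:: a; b; c] ->
    forall L : {set T}, L \in lines Pi -> ~~ [&& a \in L, b \in L & c \in L].

(** Ovals of a projective plane of order [n]. *)
Definition is_oval (T : finType) (Pi : plane T) (n : nat) (K : {set T})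
    : Prop :=
  is_arc Pi K /\ #|K| = n.+1.

Definition arc_completable_to_oval (T : finType) (Pi : plane T) (n : nat)
    (K : {set T}) : Prop :=
  is_arc Pi K /\ exists O : {set T}, is_oval Pi n O /\ K \subset O.

Definition Andre_plane (F : finFieldType) (D : {set PG F 1})
    (net : {set {set 'rV[F]_2}})
    : plane ('rV[F]_2 + {set {set 'rV[F]_2}})%type :=
  completion (Andre_lines D net).

(** The points of an Andre plane corresponding to the affine points of [C];
    the carrier is the same for all Andre planes. *)
Definition Andre_image (F : finFieldType) (C : {set PG F 2})
    : {set ('rV[F]_2 + {set {set 'rV[F]_2}})%type} :=
  [set inl v | v in affine_part C].

(* Main.v *)
(** In a basis of F^2 whose first vector spans N and whose second spans T, the
    conic is a parabola y = al x^2 + ga.  A replacement block is a graph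
    y = u x^(q^m) + k, and the abscissae of its points on the parabola form a coset,
    if any, of the kernel of the additive map al x^2 - u x^(q^m).  The ratio r of two
    nonzero kernel elements satisfies r^(2^(hm-1)) = r, so it lies in the subfield
    of order 2^gcd(hm-1, ht), and this gcd is 1 or t.  Hence every block meets the
    parabola in at most two points unless t | hm - 1; in that case a suitable block
    contains 2^t points of it.  The class of the lines through T completes the
    parabola to an oval.

    It remains to see that phi sends (1,0), (0,1) to T, N in some order, i.e. that
    an Andre set determines its transversal points; exchanging the two replaces the
    index m by t - m and delta by its inverse. *)
Require Import Defs.
From HB Require Import structures.
From mathcomp Require Import all_boot all_fingroup all_algebra.
From mathcomp Require Import all_solvable all_field.
From mathcomp Require Import ring zify.

Set Implicit Arguments.
Unset Strict Implicit.
Unset Printing Implicit Defensive.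

Import GRing.Theory.
Local Open Scope ring_scope.

(** * Points of projective space and their homogeneous coordinates *)

Section Points.
Variables (F : finFieldType) (n : nat).
Implicit Types (P Q : PG F n) (v w : 'rV[F]_n.+1).

Lemma is_point_span v : v != 0 -> is_point [set a *: v | a : F].
Proof. by move=> v0; apply/existsP; exists v; rewrite v0 /=. Qed.

Lemma PG_spanE P v : v \in PG_set P -> v != 0 ->
  PG_set P = [set a *: v | a : F].
Proof.
case: P => U /= /existsP[w /andP[w0 /eqP->]] /imsetP[b _ ->{v}].
rewrite scaler_eq0 negb_or => /andP[b0 _].
apply/setP => x; apply/imsetP/imsetP => -[a _ ->].
  by exists (a / b) => //; rewrite scalerA divfK.
by exists (a * b) => //; rewrite scalerA.
Qed.

Lemma PG_memP P v w : v \in PG_set P -> v != 0 ->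
  reflect (exists a, w = a *: v) (w \in PG_set P).
Proof.
move=> vP v0; rewrite (PG_spanE vP v0).
by apply: (iffP imsetP) => [[a _ ->]|[a ->]]; exists a.
Qed.

Lemma PG_memZ P v a : v \in PG_set P -> a *: v \in PG_set P.
Proof.
case: P => U /= /existsP[w /andP[w0 /eqP->]] /imsetP[b _ ->{v}].
by rewrite scalerA; apply: imset_f.
Qed.

Lemma PG_eq P Q v : v \in PG_set P -> v \in PG_set Q -> v != 0 -> P = Q.
Proof.
by move=> vP vQ v0; apply: val_inj; rewrite /= (PG_spanE vP v0) (PG_spanE vQ v0).
Qed.

Lemma PG_nonzero P : exists2 v, v != 0 & v \in PG_set P.
Proof.
case: P => U /= /existsP[w /andP[w0 /eqP->]]; exists w => //.
by apply/imsetP; exists 1; rewrite ?scale1r.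
Qed.

Lemma PG_through v : v != 0 -> exists P, v \in PG_set P.
Proof.
move=> v0; exists (MkPG (is_point_span v0)) => /=.
by apply/imsetP; exists 1; rewrite ?scale1r.
Qed.

Lemma induces_mem (A : 'M[F]_n.+1) s P v :
  induces A s -> v \in PG_set P -> v *m A \in PG_set (s P).
Proof. by move=> /forallP/(_ P)/eqP-> vP; apply: imset_f. Qed.

End Points.

Lemma infty_mem (F : finFieldType) (P : PG F 1) (v : 'rV[F]_2) :
  ((row_mx v 0 : 'rV[F]_(2 + 1)) \in PG_set (infty P)) = (v \in PG_set P).
Proof.
apply/imsetP/idP => [[w wP /eq_row_mx[-> _]] //|vP]; by exists v.
Qed.

(** * Arcs and ovals in the completion of an affine plane *)

Section Completion.
Variables (V : finType) (B : {set {set V}}).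

Lemma is_arc_sub (T : finType) (Pi : plane T) (K O : {set T}) :
  K \subset O -> is_arc Pi O -> is_arc Pi K.
Proof.
move=> /subsetP sKO [sOP arcO]; split.
  by apply/subsetP => x /sKO; apply/subsetP: x.
by move=> a b c aK bK cK; apply: arcO; apply: sKO.
Qed.

Definition completed_line (l : {set V}) : {set V + {set {set V}}} :=
  inr (parallel_class B l) |: [set inl v | v in l].

Lemma completed_line_inl l v : (inl v \in completed_line l) = (v \in l).
Proof. by rewrite !inE mem_imset //; apply: inl_inj. Qed.

Lemma completed_line_inr l c :
  (inr c \in completed_line l) = (c == parallel_class B l).
Proof.
rewrite !inE; apply/orP/eqP => [[/eqP[->//]|/imsetP[? _ //]]|->].
by left.
Qed.

Lemma completion_not_arc (K l : {set V}) a b c :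
  l \in B -> uniq [:: a; b; c] -> a \in K -> b \in K -> c \in K ->
  a \in l -> b \in l -> c \in l ->
  ~ is_arc (completion B) [set inl v | v in K].
Proof.
move=> lB abc aK bK cK al bl cl [_ arcK].
have /negP[] := @arcK (inl a) (inl b) (inl c) (imset_f _ aK) (imset_f _ bK)
  (imset_f _ cK) (etrans (map_inj_uniq (@inl_inj _ _) [:: a; b; c]) abc)
  (completed_line l) (setU1r _ (imset_f _ lB)).
by rewrite !completed_line_inl al bl cl.
Qed.

(** The oval is [K] with the parallel class of [l0] adjoined. A line through this new point has the
    same class as [l0], so the last hypothesis leaves it at most one point of [K]; the line at
    infinity contains no point of [K]. *)
Lemma completion_oval (K l0 : {set V}) (n : nat) :
  #|K| = n -> l0 \in B ->
  (forall l a b c, l \in B -> uniq [:: a; b; c] ->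
     a \in K -> b \in K -> c \in K -> a \in l -> b \in l -> c \in l -> False) ->
  (forall l a b, l \in B -> l = l0 \/ [disjoint l & l0] -> a \in K -> b \in K ->
     a \in l -> b \in l -> a = b) ->
  arc_completable_to_oval (completion B) n [set inl v | v in K].
Proof.
move=> cardK l0B no3 no2.
pose T0 : V + {set {set V}} := inr (parallel_class B l0).
pose O := T0 |: [set inl v | v in K].
have sKO : [set inl v | v in K] \subset O by apply: subsetUr.
have OP x : x \in O -> x = T0 \/ exists2 v, v \in K & x = inl v.
  by move=> /setU1P[|/imsetP]; [left | right].
have in2 l a b : l \in B -> a \in K -> b \in K -> inl a != inl b :> _ + {set {set V}} ->
    T0 \in completed_line l -> inl a \in completed_line l ->
    inl b \in completed_line l -> False.
  rewrite completed_line_inr !completed_line_inl => lB aK bK ab /eqP eqc al bl.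
  suff eab : a = b by rewrite eab eqxx in ab.
  apply: (no2 l a b) => //.
  (* Every line belongs to its own class, so equality of the two classes puts [l] in that of
     [l0]. *)
  have: l \in parallel_class B l by rewrite inE lB eqxx.
  by rewrite -eqc inE => /andP[_ /orP[/eqP|]]; [left | right].
suff arcO : is_arc (completion B) O.
  split; first exact: is_arc_sub arcO.
  exists O; split=> //; split=> //.
  rewrite cardsU1 card_imset ?cardK; last exact: inl_inj.
  by case: imsetP => [[]|].
split.
  apply/subsetP => x /OP[->|[v vK ->]]; apply/setUP.
    by right; apply: imset_f.
  by left; apply: imset_f.
move=> a b c aO bO cO abc L LB; apply/negP => /and3P[].
have {LB} [->|[l lB ->]] : L = [set inr (parallel_class B l) | l in B] \/
    exists2 l, l \in B & L = completed_line l.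
- by move: LB => /setU1P[|/imsetP]; [left | right].
- have inf x : x \in O -> x \in [set inr (parallel_class B l) | l in B] ->
      x = T0 by move=> /OP[//|[v _ ->]] /imsetP[].
  by move=> /(inf _ aO) ea /(inf _ bO) eb _; rewrite ea eb /= inE eqxx in abc.
have /andP[/andP[ab ac] bc] : (a != b) && (a != c) && (b != c).
  by move: abc; rewrite /= !inE negb_or andbT.
have [Ea|[a' aK Ea]] := OP _ aO; have [Eb|[b' bK Eb]] := OP _ bO;
  have [Ec|[c' cK Ec]] := OP _ cO; rewrite Ea Eb Ec ?eqxx // in ab ac bc *.
- by move=> Tl bl cl; apply: (in2 l b' c').
- by move=> al Tl cl; apply: (in2 l a' c').
- by move=> al bl Tl; apply: (in2 l a' b').
rewrite !completed_line_inl => al bl cl; apply: (no3 l a' b' c') => //.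
rewrite -(map_inj_uniq (@inl_inj V {set {set V}})) /= !inE negb_or.
by rewrite ab ac bc.
Qed.

End Completion.

(** * The norm *)

(** [X^d - c] divides [X^(d k) - c^k = X^(d k) - 1], hence [X^#|F| - X], which is the product of all
    [X - x]; so it splits into distinct linear factors. *)
Lemma exp_roots (F : finFieldType) (d k : nat) (c : F) :
  (0 < d)%N -> (d * k = #|F|.-1)%N -> c ^+ k = 1 ->
  exists rs : seq F, [/\ uniq rs, size rs = d & forall x, x \in rs -> x ^+ d = c].
Proof.
move=> d0 dk ck.
have: ('X^d - c%:P : {poly F}) %| 'X^#|F| - 'X.
  have -> : #|F| = (k * d).+1 by rewrite mulnC dk prednK // (cardD1 0).
  have -> : 'X^((k * d).+1) - 'X = 'X * ('X^d ^+ k - c%:P ^+ k) :> {poly F}.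
    by rewrite -polyC_exp ck mulrBr mulr1 exprS mulnC exprM.
  by rewrite subrXX; apply/dvdp_mull/dvdp_mulr.
rewrite finField_genPoly => /dvdp_prod_XsubC[m].
set rs := mask _ _ => eqp; exists rs; split.
- by apply/mask_uniq/index_enum_uniq.
- by have := eqp_size eqp; rewrite size_XnsubC // size_prod_XsubC => -[].
move=> x xrs; have: root ('X^d - c%:P) x by rewrite (eqp_root eqp) root_prod_XsubC.
by rewrite rootE !hornerE subr_eq0 => /eqP.
Qed.

Section Norm.
Variables (F : finFieldType) (q h t : nat).
Hypotheses (q_even : q = (2 ^ h)%N) (q_ge3 : (3 <= q)%N) (t_ge3 : (3 <= t)%N).
Hypothesis card_F : #|F| = (q ^ t)%N.

Let e := (\sum_(i < t) q ^ i)%N.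

Lemma pchar2 : 2%N \in [pchar F].
Proof. by apply: (@card_finPcharP _ _ (h * t)); rewrite // expnM -q_even. Qed.

Lemma exprD_2pow (R : comNzRingType) (x y : R) k : 2%N \in [pchar R] ->
  (x + y) ^+ (2 ^ k) = x ^+ (2 ^ k) + y ^+ (2 ^ k).
Proof.
by move=> R2; apply: exprDn_pchar; rewrite (eq_pnat _ (pcharf_eq R2)) pnatX pnat_id.
Qed.

Lemma expr_2pow_inj k : injective (fun x : F => x ^+ (2 ^ k)).
Proof.
move=> x y /= exy; apply/eqP; rewrite -subr_eq0.
have: (x - y) ^+ (2 ^ k) == 0.
  rewrite (oppr_pchar2 pchar2) exprD_2pow ?pchar2 // exy.
  by rewrite (addrr_pchar2 pchar2).
by rewrite expf_eq0 => /andP[].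
Qed.

Lemma card_F_predE : (e * q.-1 = #|F|.-1)%N.
Proof. by rewrite card_F predn_exp mulnC. Qed.

(** Isolates the two lowest digits of [e] in base [q], ready for expanding an [e]-th power modulo
    [X^(q^2)]; [0 < r] makes [q + 1] smaller than [e]. *)
Lemma norm_exponentE : exists2 r, (0 < r)%N & e = (1 + q + q ^ 2 * r)%N.
Proof.
exists (\sum_(i < t.-2) q ^ i)%N.
  by case: t t_ge3 => [|[|[|s]]] //= _; rewrite big_ord_recl.
rewrite /e; case: t t_ge3 => [|[|s]] //= _.
rewrite 2!big_ord_recl addnA; congr (_ + _)%N.
by rewrite big_distrr; apply: eq_bigr => i _; rewrite -[RHS]expnD.
Qed.

Lemma norm_mul (x y : F) : norm q t (x * y) = norm q t x * norm q t y.
Proof. exact: exprMn. Qed.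

Lemma norm_exp (x : F) k : norm q t (x ^+ k) = norm q t x ^+ k.
Proof. by rewrite /norm -!exprM mulnC. Qed.

Lemma norm_inv (x : F) : norm q t x^-1 = (norm q t x)^-1.
Proof. exact: exprVn. Qed.

Lemma norm_eq0 (x : F) : (norm q t x == 0) = (x == 0).
Proof.
by rewrite /norm -/e expf_eq0; have [r _ ->] := norm_exponentE; rewrite add1n.
Qed.

Lemma norm_expq (x : F) : norm q t x ^+ q = norm q t x.
Proof.
rewrite /norm -/e -exprM -(prednK (ltnW (ltnW q_ge3))) mulnS card_F_predE exprD.
have [->|x0] := eqVneq x 0.
  by have [r _ ->] := norm_exponentE; rewrite add1n expr0n mul0r.
apply: (mulfI x0); rewrite mulrCA -exprS prednK ?expf_card; last by rewrite (cardD1 0).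
exact: mulrC.
Qed.

Lemma exp_q_m (x : F) m : x ^+ q = x -> x ^+ (q ^ m) = x.
Proof. by move=> xq; elim: m => // m IHm; rewrite expnS exprM xq. Qed.

(** The equation [delta ^+ q = delta] expresses that [delta] lies in the subfield of order [q]. For
    nonzero [delta] it gives [delta^(q-1) = 1], the solvability condition of [exp_roots]. *)
Lemma norm_fiber (delta : F) : delta != 0 -> delta ^+ q = delta ->
  exists rs : seq F,
    [/\ uniq rs, size rs = e & forall x, x \in rs -> norm q t x = delta].
Proof.
move=> d0 dq; apply: (exp_roots _ card_F_predE).
  by have [r _ ->] := norm_exponentE.
apply: (mulfI d0); rewrite mulr1 -exprS prednK //.
exact: ltnW (ltnW q_ge3).
Qed.

Lemma norm_onto (delta : F) : delta != 0 -> delta ^+ q = delta ->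
  exists x, norm q t x = delta.
Proof.
move=> d0 dq; have [[|x rs] [_ size_rs rsP]] := norm_fiber d0 dq.
  by have [r _ eE] := norm_exponentE; rewrite eE in size_rs.
by exists x; apply: rsP; rewrite mem_head.
Qed.

(** Additivity of Frobenius factors [(b + dX)^e] as [(b + dX) (b^q + d^q X^q) (b^(q^2) + d^(q^2)
    X^(q^2))^r]. The last factor is [b^(q^2 r)] modulo [X^(q^2)], and [q + 1 < q^2], so the
    coefficients at [X] and [X^(q+1)] come from the first two factors. *)
Lemma norm_linear_coefs r (b d : F) : e = (1 + q + q ^ 2 * r)%N ->
  exists p : {poly F}, [/\ (size p <= e.+1)%N,
    forall x, p.[x] = norm q t (b + d * x),
    p`_1 = b ^+ (q ^ 2 * r) * (d * b ^+ q) &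
    p`_(q.+1) = b ^+ (q ^ 2 * r) * d ^+ q.+1].
Proof.
move=> eE.
have P2 : 2%N \in [pchar {poly F}] by rewrite pchar_poly pchar2.
have Dq k : (b%:P + d *: 'X) ^+ (q ^ k) =
    (b ^+ (q ^ k))%:P + d ^+ (q ^ k) *: 'X^(q ^ k) :> {poly F}.
  by rewrite q_even -expnM exprD_2pow // exprZn polyC_exp.
have [S pE] : exists S, (b%:P + d *: 'X) ^+ (1 + q + q ^ 2 * r) =
    (b ^+ (q ^ 2 * r) * b ^+ q.+1)%:P + (b ^+ (q ^ 2 * r) * (d * b ^+ q))%:P * 'X
    + (b ^+ (q ^ 2 * r) * (b * d ^+ q))%:P * 'X^q
    + (b ^+ (q ^ 2 * r) * d ^+ q.+1)%:P * 'X^(q.+1) + S * 'X^(q ^ 2) :> {poly F}.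
  rewrite !exprD expr1 exprM Dq; have := Dq 1%N; rewrite !expn1 => ->.
  rewrite [b ^+ (_ * _)]exprM; set y := (b ^+ (q ^ 2)); set z := d ^+ (q ^ 2).
  have /eqP := subrXX (y%:P + z *: 'X^(q ^ 2)) y%:P r.
  rewrite subr_eq addrAC subrr add0r; set S := \sum_(_ < r) _ => /eqP->.
  exists ((b%:P + d *: 'X) * ((b ^+ q)%:P + d ^+ q *: 'X^q) * z%:P * S).
  rewrite -!mul_polyC !polyCM !polyC_exp !exprS; ring.
have q1 : (1 < q)%N := ltnW q_ge3.
have qq : (q.+1 < q ^ 2)%N by rewrite expnS expn1; nia.
have q0 : (0 < q)%N := ltnW q1.
exists ((b%:P + d *: 'X) ^+ e); split.
- apply: leq_trans (size_exp_leq _ _) _; rewrite ltnS -{2}[e]mul1n leq_mul2r.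
  apply/orP; right; rewrite -subn1 leq_subLR.
  apply: leq_trans (size_polyD _ _) _; rewrite geq_max.
  rewrite (leq_trans (size_polyC_leq1 _)) //.
  by rewrite (leq_trans (size_scale_leq _ _)) // size_polyX.
- by move=> x; rewrite !hornerE.
all: rewrite eE pE !coefD !coefC !coefCM !coefX !coefXn !coefMXn /=.
  rewrite ifT; last by rewrite (ltn_trans _ qq).
  by rewrite (ltn_eqF q1) eqSS (ltn_eqF q0) /= !(mulr0, mulr1, addr0, add0r).
rewrite ifT //.
by rewrite !eqSS eqxx (gtn_eqF q0) (gtn_eqF (ltnSn _)) /= !(mulr0, mulr1, addr0, add0r).
Qed.

(* (b + dX)^e - kappa (a + cX)^e has degree at most e and vanishes at the e roots of
   X^e - delta, so it is a multiple of X^e - delta; as 1 < q + 1 < e, its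
   coefficients at X and X^(q+1) vanish. *)
Lemma norm_ratio_constant (a b c d kappa delta : F) :
  kappa != 0 -> a * d != b * c -> delta != 0 -> delta ^+ q = delta ->
  (forall x, norm q t x = delta ->
     norm q t (b + d * x) = kappa * norm q t (a + c * x)) ->
  (a = 0 /\ d = 0) \/ (b = 0 /\ c = 0).
Proof.
move=> k0 adbc d0 dq eqN.
have [rs [rs_uniq size_rs rsP]] := norm_fiber d0 dq.
have [r r0 eE] := norm_exponentE.
have [p1 [size_p1 p1E p1_1 p1_q]] := norm_linear_coefs b d eE.
have [p2 [size_p2 p2E p2_1 p2_q]] := norm_linear_coefs a c eE.
have e0 : (0 < e)%N by rewrite eE.
pose p := p1 - kappa *: p2; pose w : {poly F} := 'X^e - delta%:P.
have pw : p = p`_e *: w.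
  apply/eqP; rewrite -subr_eq0; apply/eqP/(@roots_geq_poly_eq0 _ _ rs) => //.
    apply/allP => x xrs; rewrite rootE !hornerE p1E p2E.
    by have xd := rsP _ xrs; rewrite eqN // subrr -xd subrr mulr0 subrr.
  rewrite size_rs; apply/leq_sizeP => j; rewrite leq_eqVlt => /orP[/eqP<-|ej].
    rewrite !(coefB, coefZ, coefXn, coefC) eqxx.
    by rewrite (gtn_eqF e0) subr0 mulr1 subrr.
  rewrite !(coefB, coefZ, coefXn, coefC) (gtn_eqF ej).
  rewrite (gtn_eqF (leq_trans _ ej)) // subrr mulr0 subr0.
  by rewrite !nth_default ?mulr0 ?subrr //; apply: leq_trans ej.
have coef0 j : (0 < j < e)%N -> p1`_j = kappa * p2`_j.
  move=> /andP[j0 je]; apply/eqP; rewrite -subr_eq0 -coefZ -coefB -/p pw.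
  by rewrite !(coefB, coefZ, coefXn, coefC) (ltn_eqF je) (gtn_eqF j0) subrr mulr0.
have q0 : (0 < q)%N := ltnW (ltnW q_ge3).
have e_gt : (q.+1 < e)%N by rewrite eE; move: q_ge3 r0; clear; nia.
have := coef0 1%N; rewrite p1_1 p2_1 (ltn_trans _ e_gt) // => /(_ isT) E1.
have := coef0 q.+1; rewrite p1_q p2_q e_gt => /(_ isT) Eq.
have Q0 : (0 < q ^ 2 * r)%N by rewrite muln_gt0 r0 expn_gt0 q0.
move: Q0 E1 Eq; set Q := (q ^ 2 * r)%N => Q0.
have [b0|b0] := eqVneq b 0.
  rewrite b0 [0 ^+ Q]expr0n gtn_eqF // !mul0r => _ /esym/eqP.
  rewrite !mulf_eq0 (negPf k0) !expf_eq0 Q0 /= => /orP[/eqP a0|/eqP c0]; last by right.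
  by rewrite a0 b0 !mul0r eqxx in adbc.
have [a0|a0] := eqVneq a 0.
  rewrite a0 [0 ^+ Q]expr0n gtn_eqF // !(mul0r, mulr0) => _ /eqP.
  by rewrite !mulf_eq0 !expf_eq0 Q0 (negPf b0) /= => /eqP d_0; left.
have [c0|c0] := eqVneq c 0.
  rewrite c0 !(mul0r, mulr0) => /eqP.
  rewrite !mulf_eq0 !expf_eq0 Q0 q0 (negPf b0) /= orbF => /eqP d_0.
  by rewrite d_0 c0 !mulr0 eqxx in adbc.
(* Now [a], [b], [c] are nonzero, and by [E1] so is [d]. Comparing [E1] with [Eq] gives
   [b^q / d^q = a^q / c^q], so [(ad)^q = (bc)^q], and injectivity of Frobenius contradicts
   [adbc]. *)
move=> E1 Eq; case/negP: adbc; apply/eqP.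
apply: (@expr_2pow_inj h); rewrite /= -q_even.
have b0' n : b ^+ n != 0 by rewrite expf_neq0.
have a0' n : a ^+ n != 0 by rewrite expf_neq0.
have d_0 : d != 0.
  apply: contraNneq k0 => d_0; move/eqP: E1; rewrite d_0 !(mul0r, mulr0) eq_sym.
  by rewrite !mulf_eq0 (negPf (a0' _)) (negPf (a0' _)) (negPf c0) !orbF.
apply: (mulfI (mulf_neq0 (mulf_neq0 (b0' Q) d_0)
  (mulf_neq0 k0 (mulf_neq0 (a0' Q) c0)))).
rewrite !exprMn; move: E1 Eq; rewrite !exprS.
set A := a ^+ q; set B := b ^+ q; set A' := a ^+ Q; set B' := b ^+ Q.
set C := c ^+ q; set D := d ^+ q => E1 Eq.
transitivity ((B' * (d * D)) * (kappa * (A' * (c * A)))); first by ring.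
rewrite Eq -E1; ring.
Qed.

(** * Elements fixed by powers of the squaring map *)

Lemma exp2_pow_fixed_mul (k n : nat) (x : F) :
  x ^+ (2 ^ k) = x -> x ^+ (2 ^ (n * k)) = x.
Proof.
by move=> xk; elim: n => [|n IHn]; rewrite ?expr1 // mulSn expnD exprM xk.
Qed.

(** A Bezout relation [u a = v b + 1] yields [x = x^(2^(u a)) = (x^(2^(v b)))^2 = x^2]. *)
Lemma exp2_pow_fixed_coprime (a b : nat) (x : F) : (0 < a)%N -> coprime a b ->
  x ^+ (2 ^ a) = x -> x ^+ (2 ^ b) = x -> x ^+ 2 = x.
Proof.
move=> a0 /eqP ab xa xb; case: (egcdnP b a0) => u v; rewrite ab => uv _.
by rewrite -{2}(exp2_pow_fixed_mul u xa) uv expnD exprM exp2_pow_fixed_mul.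
Qed.

(** As [k] divides [h t], the field [F] contains the subfield of order [2^k]. Its nonzero elements
    are the roots of [X^(2^k - 1) - 1], and there is more than one of them. *)
Lemma exp2_pow_nontrivial k : (1 < k)%N -> (k %| h * t)%N ->
  exists r : F, [/\ r != 0, r != 1 & r ^+ (2 ^ k) = r].
Proof.
move=> k1 /dvdnP[j hjk].
have cF : #|F| = (2 ^ (k * j))%N by rewrite card_F q_even -expnM hjk mulnC.
have k2 : (2 < 2 ^ k)%N by rewrite (leq_trans _ (leq_pexp2l _ k1)).
have p0 : (0 < (2 ^ k).-1)%N by move: k2; case: (2 ^ k)%N => [|[]].
have [|||rs [rs_uniq size_rs rsP]] :=
  @exp_roots F (2 ^ k).-1 (\sum_(i < j) (2 ^ k) ^ i)%N 1.
- exact: p0.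
- by rewrite cF expnM [RHS]predn_exp.
- exact: expr1n.
have [r rrs r1] : exists2 r, r \in rs & r != 1.
  apply/hasP; rewrite -[has _ _]negbK -all_predC; apply/negP => /allP all1.
  have: (size rs <= size [:: 1%R : F])%N.
    by apply: uniq_leq_size => // x /all1 /=; rewrite negbK mem_seq1.
  by rewrite size_rs /= => le1; move: k2 le1; clear; lia.
exists r; split=> //.
  apply/eqP => r0; have /eqP := rsP r rrs.
  by rewrite r0 expr0n gtn_eqF // eq_sym oner_eq0.
by rewrite -(prednK (ltnW (ltnW k2))) exprS rsP // mulr1.
Qed.

End Norm.

(** * The conic in affine coordinates *)

Section Coordinates.
Variable F : finFieldType.
Implicit Types (x y : F) (v : 'rV[F]_2) (psi : 'M[F]_2).

Lemma vec2D x y x' y' : vec2 x y + vec2 x' y' = vec2 (x + x') (y + y').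
Proof. by apply/rowP => i; rewrite !mxE; case: i => [[|[]]]. Qed.

Lemma vec2Z a x y : a *: vec2 x y = vec2 (a * x) (a * y).
Proof. by apply/rowP => i; rewrite !mxE; case: i => [[|[]]]. Qed.

Lemma vec2E x y : vec2 x y = x *: vec2 1 0 + y *: vec2 0 1.
Proof. by rewrite !vec2Z vec2D !(mulr1, mulr0, addr0, add0r). Qed.

Lemma vec2_0 : vec2 0 0 = 0 :> 'rV[F]_2.
Proof. by apply/rowP => i; rewrite !mxE; case: i => [[|[]]]. Qed.

Lemma vec2_inj x y x' y' : vec2 x y = vec2 x' y' -> x = x' /\ y = y'.
Proof.
by move=> /rowP eqv; have := eqv 0; have := eqv 1; rewrite !mxE.
Qed.

Lemma vec2_surj v : exists x y, v = vec2 x y.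
Proof.
exists (v 0 0), (v 0 1); apply/rowP => i; rewrite mxE.
by case: i => [[|[|//]] lti]; congr (v _ _); apply: val_inj.
Qed.

Lemma vec2_coords psi v : psi \in unitmx -> exists x y, v = vec2 x y *m psi.
Proof.
move=> Upsi; have [x [y xy]] := vec2_surj (v *m invmx psi).
by exists x, y; rewrite -xy mulmxKV.
Qed.

Lemma vec2M_inj psi x y x' y' : psi \in unitmx ->
  vec2 x y *m psi = vec2 x' y' *m psi -> x = x' /\ y = y'.
Proof. by move=> Upsi /(can_inj (mulmxK Upsi)); apply: vec2_inj. Qed.

Lemma vec2M_neq0 psi x y : psi \in unitmx -> (x != 0) || (y != 0) ->
  vec2 x y *m psi != 0.
Proof.
move=> Upsi; apply: contraTneq; rewrite -(mul0mx _ psi) -vec2_0.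
by move=> /(vec2M_inj Upsi)[-> ->]; rewrite eqxx.
Qed.

End Coordinates.

Section Conic.
Variables (F : finFieldType) (psi : 'M[F]_2).
Hypothesis Upsi : psi \in unitmx.
Implicit Types (x y z : F) (P : PG F 2) (N T : PG F 1).

(** Homogeneous coordinates whose first two entries refer to the basis of [F^2] formed by the rows
    of [psi]; the line at infinity keeps the equation [z = 0]. *)
Let pt x y z : 'rV[F]_(2 + 1) := row_mx (vec2 x y *m psi) z%:M.

Let ptD x y z x' y' z' : pt x y z + pt x' y' z' = pt (x + x') (y + y') (z + z').
Proof. by rewrite add_row_mx -mulmxDl vec2D -raddfD. Qed.

Let ptZ a x y z : a *: pt x y z = pt (a * x) (a * y) (a * z).
Proof. by rewrite scale_row_mx scalemxAl vec2Z scale_scalar_mx. Qed.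

Let pt_inj x y z x' y' z' :
  pt x y z = pt x' y' z' -> [/\ x = x', y = y' & z = z'].
Proof.
move=> /eq_row_mx[/(vec2M_inj Upsi)[-> ->]] /matrixP/(_ 0 0).
by rewrite !mxE !mulr1n.
Qed.

Let pt0 : pt 0 0 0 = 0.
Proof. by rewrite /pt vec2_0 mul0mx raddf0 row_mx0. Qed.

Let pt_surj (v : 'rV[F]_3) : exists x y z, v = pt x y z.
Proof.
have [x [y xy]] := vec2_coords (lsubmx (v : 'rV[F]_(2 + 1))) Upsi.
exists x, y, (rsubmx (v : 'rV[F]_(2 + 1)) 0 0).
by rewrite /pt -xy -mx11_scalar hsubmxK.
Qed.

Let pt_neq0 x y z : [|| x != 0, y != 0 | z != 0] -> pt x y z != 0.
Proof.
by apply: contraTneq; rewrite -pt0 => /pt_inj[-> -> ->]; rewrite eqxx.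
Qed.

Let pt_last x y z : (pt x y z : 'rV_3) 0 ord_max = z.
Proof.
have -> : ord_max = rshift 2 (0 : 'I_1) by apply: val_inj.
by rewrite /pt (@row_mxEr _ 1 2 1) mxE.
Qed.

Lemma qform_coords (A : 'M[F]_3) : exists a b c d e f : F,
  forall x y z, qform A (pt x y z) =
    a * x ^+ 2 + b * y ^+ 2 + c * z ^+ 2 + d * x * y + e * x * z + f * y * z.
Proof.
pose B (v w : 'rV[F]_3) := (v *m A *m w^T) 0 0.
have BDl v v' w : B (v + v') w = B v w + B v' w by rewrite /B !mulmxDl mxE.
have BDr v w w' : B v (w + w') = B v w + B v w'.
  by rewrite /B raddfD /= mulmxDr mxE.
have BZl a v w : B (a *: v) w = a * B v w by rewrite /B -!scalemxAl mxE.
have BZr a v w : B v (a *: w) = a * B v w.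
  by rewrite /B linearZ /= -scalemxAr mxE.
set e1 := pt 1 0 0; set e2 := pt 0 1 0; set e3 := pt 0 0 1.
exists (B e1 e1), (B e2 e2), (B e3 e3), (B e1 e2 + B e2 e1), (B e1 e3 + B e3 e1),
  (B e2 e3 + B e3 e2) => x y z.
have -> : pt x y z = x *: e1 + y *: e2 + z *: e3.
  by rewrite !ptZ !ptD !(mulr1, mulr0, addr0, add0r).
rewrite -[LHS]/(B _ _) !(BDl, BDr, BZl, BZr); ring.
Qed.

Lemma qformZ (A : 'M[F]_3) a v : qform A (a *: v) = a ^+ 2 * qform A v.
Proof.
by rewrite /qform linearZ /= -scalemxAr -!scalemxAl !mxE mulrA.
Qed.

Lemma forall_PG_mem P (v : 'rV[F]_3) (p : pred 'rV[F]_3) :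
  (forall a v, p v -> p (a *: v)) -> v \in PG_set P -> v != 0 ->
  [forall v in PG_set P, p v] = p v.
Proof.
move=> pZ vP v0; apply/forall_inP/idP => [|pv w]; first exact.
by move=> /(PG_memP _ vP v0)[a ->]; apply: pZ.
Qed.

(** In these coordinates N is [(1, 0, 0)] and T is [(0, 1, 0)]. Since [z = 0] meets the conic only
    in T, [b = d = 0] and [a] is nonzero; nondegeneracy makes [f] nonzero; the nucleus gives
    [e = 0]. What remains is [a x^2 + c z^2 + f y z = 0]. *)
Lemma affine_conic_parabola (C : {set PG F 2}) N T :
  is_conic C -> is_nucleus C (infty N) ->
  tangent_at C (line_at_infinity F) (infty T) ->
  vec2 1 0 *m psi \in PG_set N -> vec2 0 1 *m psi \in PG_set T ->
  exists al ga, al != 0 /\ forall x y,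
    (vec2 x y *m psi \in affine_part C) = (y == al * x ^+ 2 + ga).
Proof.
move=> [A Andeg CE] Nnuc [_ Ttan] N1 T1.
have [a [b [c [d [e [f QE]]]]]] := qform_coords A.
have memC P x y z : pt x y z \in PG_set P -> pt x y z != 0 ->
    (P \in C) = (qform A (pt x y z) == 0).
  move=> xP x0; rewrite CE inE.
  apply: (forall_PG_mem (p := fun v => qform A v == 0)) xP x0 => k v.
  by rewrite qformZ => /eqP->; rewrite mulr0.
have T2 : pt 0 1 0 \in PG_set (infty T) by rewrite /pt raddf0 infty_mem.
have N2 : pt 1 0 0 \in PG_set (infty N) by rewrite /pt raddf0 infty_mem.
have p010 : pt 0 1 0 != 0 by rewrite pt_neq0 // oner_neq0 orbT.
have p100 y : pt 1 y 0 != 0 by rewrite pt_neq0 // oner_neq0.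
have TC : infty T \in C :&: line_at_infinity F by rewrite Ttan set11.
have b0 : b = 0.
  move: TC; rewrite inE (memC _ _ _ _ T2) // QE => /andP[/eqP + _].
  by rewrite !(mulr0, expr1n, mulr1, add0r, addr0, expr0n).
(* The points at infinity other than T are the [(1, y, 0)], and [a + d y] is the value of the form
   there. *)
have ad y : a + d * y != 0.
  apply/eqP => ady; have [P yP] := PG_through (p100 y).
  have: P \in C :&: line_at_infinity F.
    rewrite inE (memC _ _ _ _ yP) // QE b0; apply/andP; split.
      by rewrite !(mulr0, mul0r, expr1n, mulr1, add0r, addr0, expr0n) ady.
    rewrite inE (forall_PG_mem (p := fun v => v 0 ord_max == 0) _ yP) //.
      by rewrite pt_last.
    by move=> k v /eqP vk; rewrite mxE vk mulr0.
  rewrite Ttan => /set1P PT; move: yP; rewrite PT => /(PG_memP _ T2 p010)[k].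
  by rewrite ptZ mulr0 => /pt_inj[/eqP]; rewrite oner_eq0.
have a0 : a != 0 by have := ad 0; rewrite mulr0 addr0.
have d0 : d = 0.
  by apply/eqP/negPn/negP => d0; have := ad (- a / d); rewrite mulrC divfK // subrr eqxx.
(* With [f = 0] the vector of T, a zero of the form, would lie in the radical of the polar form. *)
have f0 : f != 0.
  apply: contraNneq p010 => f0; apply/eqP/Andeg.
    by rewrite QE b0 f0; ring.
  move=> w; have [x [y [z ->]]] := pt_surj w.
  by rewrite /polar ptD !QE b0 f0 d0; ring.
(* The line [L] joins the point [P0] of the conic to the radical (f, -e, 0) of
   the polar form, hence it is tangent at [P0]. *)
have [P0 P0P] : exists P, pt 0 (- c / f) 1 \in PG_set P.
  by apply/PG_through/pt_neq0; rewrite oner_neq0 !orbT.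
pose w : 'cV[F]_3 := col_mx (invmx psi *m (vec2 e f)^T) c%:M.
have wE x y z : (pt x y z *m w == 0) = (e * x + f * y + c * z == 0).
  have -> : pt x y z *m w = (e * x + f * y + c * z)%:M.
    rewrite /pt (@mul_row_col _ 1 2 1 1) mulmxA mulmxK // -scalar_mxM.
    apply/matrixP => i j; rewrite !ord1 !mxE !big_ord_recl big_ord0 !mxE /=; ring.
  apply/eqP/eqP => [/matrixP/(_ 0 0)|->]; last exact: raddf0.
  by rewrite !mxE.
pose L := [set P : PG F 2 | [forall v in PG_set P, v *m w == 0]].
have memL P x y z : pt x y z \in PG_set P -> pt x y z != 0 ->
    (P \in L) = (e * x + f * y + c * z == 0).
  move=> xP x0; rewrite inE -wE.
  apply: (forall_PG_mem (p := fun v => v *m w == 0)) xP x0 => k v.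
  by rewrite -scalemxAl => /eqP->; rewrite scaler0.
have tanL : tangent_at C L P0.
  split.
    exists w => //; apply: contraNneq f0 => w0.
    have := wE 0 1 0.
    by rewrite w0 mulmx0 eqxx !(mulr0, mulr1, add0r, addr0) => <-.
  apply/setP => P; have [v v0] := PG_nonzero P; have [x [y [z vE]]] := pt_surj v.
  rewrite vE in v0 * => vP.
  rewrite in_setI in_set1 (memC _ _ _ _ vP) // (memL _ _ _ _ vP) // QE b0 d0.
  apply/andP/eqP => [[/eqP Q0 /eqP L0]|PP0].
    have x0 : x = 0.
      apply/eqP; have /eqP : a * x ^+ 2 = 0.
        transitivity (a * x ^+ 2 + 0 * y ^+ 2 + c * z ^+ 2 + 0 * x * y + e * x * z
          + f * y * z - z * (e * x + f * y + c * z)); first by ring.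
        by rewrite Q0 L0 mulr0 subr0.
      by rewrite mulf_eq0 (negPf a0) expf_eq0.
    have y0 : y = z * (- c / f).
      apply: (mulfI f0); move/eqP: L0; rewrite x0 mulr0 add0r addr_eq0 => /eqP->.
      by field.
    apply: (PG_eq vP _ v0); rewrite x0 y0.
    by have := PG_memZ z P0P; rewrite ptZ mulr0 mulr1.
  move: vP; rewrite PP0 => /(PG_memP _ P0P)[|k].
    by rewrite pt_neq0 // oner_neq0 !orbT.
  by rewrite ptZ mulr0 mulr1 => /pt_inj[-> -> ->]; split; apply/eqP; field.
have := Nnuc L P0 tanL; rewrite (memL _ _ _ _ N2) //.
rewrite !(mulr0,mulr1,addr0) => /eqP e0.
exists (- a / f), (- c / f); split.
  by rewrite mulf_neq0 ?invr_eq0 ?oppr_eq0.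
have pt1 x y : pt x y 1 != 0 by rewrite pt_neq0 // oner_neq0 !orbT.
move=> x y; rewrite inE; transitivity (qform A (pt x y 1) == 0).
  apply/exists_inP/idP => [[P PC xP]|Q0]; first by rewrite -(memC _ _ _ _ xP).
  by have [P xP] := PG_through (pt1 x y); exists P; rewrite // (memC _ _ _ _ xP).
rewrite QE b0 d0 e0; apply/eqP/eqP => [Q0|->]; last by field.
by apply: (mulfI f0); apply/eqP; rewrite -subr_eq0 -Q0; apply/eqP; field.
Qed.

End Conic.

(** * The transversal points of an Andre set *)

Lemma PG1_basis (F : finFieldType) (P Q : PG F 1) : P != Q ->
  exists M : 'M[F]_2, [/\ M \in unitmx, vec2 1 0 *m M \in PG_set P
                       & vec2 0 1 *m M \in PG_set Q].
Proof.
move=> PQ; have [v v0 vP] := PG_nonzero P; have [w w0 wQ] := PG_nonzero Q.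
pose M : 'M[F]_2 := \matrix_(i, j) (if i == 0 then v else w) 0 j.
have M1 : vec2 1 0 *m M = v.
  apply/rowP => i; rewrite !mxE !big_ord_recl big_ord0 !mxE /=.
  by rewrite mul1r mul0r !addr0.
have M2 : vec2 0 1 *m M = w.
  apply/rowP => i; rewrite !mxE !big_ord_recl big_ord0 !mxE /=.
  by rewrite mul1r mul0r addr0 add0r.
exists M; rewrite M1 M2; split=> //; rewrite -row_free_unit -kermx_eq0.
apply/rowV0P => u /sub_kermxP; have [x [y ->]] := vec2_surj u.
rewrite vec2E mulmxDl -!scalemxAl M1 M2 => /eqP; rewrite addr_eq0 => /eqP xv.
have [x0|x0] := eqVneq x 0.
  move/eqP: xv; rewrite x0 scale0r eq_sym oppr_eq0 scaler_eq0 (negPf w0) orbF.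
  by move=> /eqP->; rewrite !scale0r addr0.
case/eqP: PQ; apply: (PG_eq vP _ v0).
rewrite -[v]scale1r -(mulVf x0) -scalerA xv -scaleNr scalerA.
exact: PG_memZ.
Qed.

Section Transversals.
Variables (F : finFieldType) (q h t : nat).
Hypotheses (q_even : q = (2 ^ h)%N) (q_ge3 : (3 <= q)%N) (t_ge3 : (3 <= t)%N).
Hypothesis card_F : #|F| = (q ^ t)%N.
Variables (T N : PG F 1) (D : {set PG F 1}).
Hypothesis D_Andre : is_Andre_set q t T N D.

(** The rows of [M] span the fixed points T and N, so they are eigenvectors of any matrix inducing
    [s]. *)
Lemma fixing_group_diag (M : 'M[F]_2) (s : {perm PG F 1}) :
  M \in unitmx -> vec2 1 0 *m M \in PG_set T -> vec2 0 1 *m M \in PG_set N ->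
  s \in fixing_group T N ->
  exists al be, [/\ al != 0, be != 0 & forall (P : PG F 1) x y,
     vec2 x y *m M \in PG_set P -> vec2 (al * x) (be * y) *m M \in PG_set (s P)].
Proof.
move=> UM MT MN; rewrite !inE => /andP[/existsP[A /andP[UA sA]] /andP[/eqP sT /eqP sN]].
have n1 : vec2 1 0 *m M != 0 by rewrite vec2M_neq0 // oner_neq0.
have n2 : vec2 0 1 *m M != 0 by rewrite vec2M_neq0 // oner_neq0 orbT.
have := induces_mem sA MT; rewrite sT => /(PG_memP _ MT n1)[al al1].
have := induces_mem sA MN; rewrite sN => /(PG_memP _ MN n2)[be be1].
exists al, be; split.
- apply: contraNneq n1 => al0; move: al1; rewrite al0 scale0r.
  by move=> /(canRL (mulmxK UA)); rewrite mul0mx => ->.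
- apply: contraNneq n2 => be0; move: be1; rewrite be0 scale0r.
  by move=> /(canRL (mulmxK UA)); rewrite mul0mx => ->.
move=> P x y /(induces_mem sA).
suff -> : vec2 x y *m M *m A = vec2 (al * x) (be * y) *m M by [].
rewrite vec2E [in RHS]vec2E !mulmxDl -!scalemxAl al1 be1 !scalerA.
by rewrite [x * _]mulrC [y * _]mulrC.
Qed.

(** An element of [H] acts as [diag(al, be)] and its order divides [#|H| = e], whence [al^e = be^e]:
    the two eigenvalues have the same norm. So the ratio of the norms of [y] and [x] is constant on
    the orbit [D]. *)
Lemma Andre_set_norm (M : 'M[F]_2) :
  M \in unitmx -> vec2 1 0 *m M \in PG_set T -> vec2 0 1 *m M \in PG_set N ->
  exists2 kappa, kappa != 0 & forall (P : PG F 1) x y, P \in D ->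
    vec2 x y *m M \in PG_set P -> norm q t y = kappa * norm q t x.
Proof.
move=> UM MT MN; have [_ [H [sHG cardH [P0 P0TN DE]]]] := D_Andre.
have [v v0 vP] := PG_nonzero P0; have [x0 [y0 vE]] := vec2_coords v UM.
rewrite vE in v0 vP; move: P0TN; rewrite !inE negb_or => /andP[P0T P0N].
have x0_neq0 : x0 != 0.
  apply: contraNneq P0N => x00; apply/eqP/(PG_eq vP _ v0).
  by have := PG_memZ y0 MN; rewrite scalemxAl vec2Z mulr0 mulr1 x00.
have y0_neq0 : y0 != 0.
  apply: contraNneq P0T => y00; apply/eqP/(PG_eq vP _ v0).
  by have := PG_memZ x0 MT; rewrite scalemxAl vec2Z mulr0 mulr1 y00.
have norm_neq0 x : x != 0 -> norm q t x != 0 by rewrite (norm_eq0 q t_ge3).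
exists (norm q t y0 / norm q t x0).
  by rewrite mulf_neq0 ?invr_eq0 // norm_neq0.
move=> P x y; rewrite DE => /orbitP[s sH <-].
have [al [be [al0 be0 albe]]] := fixing_group_diag UM MT MN (subsetP sHG s sH).
have sk k : vec2 (al ^+ k * x0) (be ^+ k * y0) *m M \in PG_set (iter k s P0).
  by elim: k => [|k IHk]; rewrite ?mul1r // !exprS -!mulrA; apply: albe.
have ab : norm q t al = norm q t be.
  have := sk #|H|; rewrite -permX expg_cardG // perm1 => /(PG_memP _ vP v0)[k].
  rewrite cardH scalemxAl vec2Z => /(vec2M_inj UM)[].
  by move=> /(mulIf x0_neq0) + /(mulIf y0_neq0) => <-.
have := sk 1%N; rewrite !expr1 => sP0.
have sn0 : vec2 (al * x0) (be * y0) *m M != 0 by rewrite vec2M_neq0 // mulf_neq0.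
move=> /(PG_memP _ sP0 sn0)[k]; rewrite scalemxAl vec2Z => /(vec2M_inj UM)[-> ->].
rewrite !norm_mul ab; field; exact: norm_neq0.
Qed.

Variables (delta : F) (phi : 'M[F]_2) (sigma : {perm PG F 1}).
Hypotheses (delta_neq0 : delta != 0) (delta_Fq : delta ^+ q = delta).
Hypotheses (phi_unit : phi \in unitmx) (phi_sigma : induces phi sigma).
Hypothesis sigma_D : [set sigma P | P in std_Andre_set q t delta] = D.

Lemma Andre_set_transversal_notin : T \notin D.
Proof.
have [M [UM MT MN]] := PG1_basis (proj1 D_Andre).
have [kappa k0 kappaP] := Andre_set_norm UM MT MN.
apply: contraNN k0 => /kappaP/(_ MT)/esym/eqP.
have n0 : norm q t (0 : F) == 0 by rewrite (norm_eq0 q t_ge3).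
by rewrite (eqP n0) mulf_eq0 [norm _ _ _ == 0](norm_eq0 q t_ge3) oner_eq0 orbF.
Qed.

(** The points [(1, x)] with [x] of norm [delta] go into [D], where the relation of [Andre_set_norm]
    holds; [norm_ratio_constant] then makes the matrix of [phi] relative to (T, N) diagonal or
    antidiagonal. *)
Lemma Andre_set_transversals :
  vec2 1 0 *m phi \in PG_set N /\ vec2 0 1 *m phi \in PG_set T \/
  vec2 1 0 *m phi \in PG_set T /\ vec2 0 1 *m phi \in PG_set N.
Proof.
have [M [UM MT MN]] := PG1_basis (proj1 D_Andre).
have [kappa k0 kappaP] := Andre_set_norm UM MT MN.
have [a [b r0]] := vec2_coords (vec2 1 0 *m phi) UM.
have [c [d r1]] := vec2_coords (vec2 0 1 *m phi) UM.
have phiE x y : vec2 x y *m phi = vec2 (x * a + y * c) (x * b + y * d) *m M.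
  rewrite vec2E mulmxDl -!scalemxAl r0 r1 !scalemxAl.
  by rewrite -mulmxDl !vec2Z vec2D.
(* If the determinant vanished, [phi] would kill [(d, -b)] and [(c, -a)]; both would be zero, and
   with them all entries. *)
have adbc : a * d != b * c.
  apply/eqP => adbc.
  have phi0 x y : x * a + y * c = 0 -> x * b + y * d = 0 -> x = 0 /\ y = 0.
    move=> E1 E2; apply: (vec2M_inj phi_unit).
    by rewrite phiE E1 E2 vec2_0 !mul0mx.
  have [|| d0 /eqP] := phi0 d (- b); [by ring: adbc | by ring |].
  rewrite oppr_eq0 => /eqP b0.
  have [|| c0 /eqP] := phi0 c (- a); [by ring | by ring: adbc |].
  rewrite oppr_eq0 => /eqP a0.
  have [|| /eqP] := phi0 1 0; rewrite ?a0 ?b0 ?mulr0 ?mul0r ?addr0 //.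
  by rewrite oner_eq0.
have MemT x : vec2 x 0 *m M \in PG_set T.
  by have := PG_memZ x MT; rewrite scalemxAl vec2Z mulr0 mulr1.
have MemN x : vec2 0 x *m M \in PG_set N.
  by have := PG_memZ x MN; rewrite scalemxAl vec2Z mulr0 mulr1.
have [|[a0 d0]|[b0 c0]] := @norm_ratio_constant _ _ _ _ q_even q_ge3 t_ge3 card_F
  a b c d kappa delta k0 adbc delta_neq0 delta_Fq.
- move=> x xd; have x0 : x != 0 by rewrite -(norm_eq0 q t_ge3) xd.
  have nx : vec2 1 x != 0 :> 'rV[F]_2.
    by rewrite -[vec2 1 x]mulmx1 vec2M_neq0 ?unitmx1 ?oner_neq0.
  have [P xP] := PG_through nx.
  have PD : sigma P \in D.
    rewrite -sigma_D; apply: imset_f; rewrite inE; apply/existsP; exists x.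
    by rewrite x0 xd eqxx.
  have := induces_mem phi_sigma xP; rewrite phiE => /(kappaP _ _ _ PD).
  by rewrite !mul1r ![x * _]mulrC.
- by left; rewrite r0 r1 a0 d0.
by right; rewrite r0 r1 b0 c0.
Qed.

End Transversals.

(** * Replacement blocks and the parabola *)

Lemma in_translate (V : finZmodType) (a v : V) (U : {set V}) :
  (v \in translate a U) = (v - a \in U).
Proof.
apply/imsetP/idP => [[u uU ->]|vU]; first by rewrite addrAC subrr add0r.
by exists (v - a); rewrite // addrC subrK.
Qed.

Section AndreLines.
Variables (F : finFieldType) (q h t : nat).
Hypotheses (q_even : q = (2 ^ h)%N) (q_ge3 : (3 <= q)%N) (t_ge3 : (3 <= t)%N).
Hypothesis card_F : #|F| = (q ^ t)%N.
Variables (psi : 'M[F]_2) (delta : F) (m : nat).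
Hypothesis Upsi : psi \in unitmx.

Lemma mem_translate_PG a1 a2 w1 w2 x y (P : PG F 1) :
  vec2 w1 w2 *m psi \in PG_set P -> (w1 != 0) || (w2 != 0) ->
  (vec2 x y *m psi \in translate (vec2 a1 a2 *m psi) (PG_set P)) =
  ((x - a1) * w2 == (y - a2) * w1).
Proof.
move=> wP w0; rewrite in_translate -mulmxBl.
have -> : vec2 x y - vec2 a1 a2 = vec2 (x - a1) (y - a2) :> 'rV[F]_2.
  by rewrite -[- vec2 _ _]scaleN1r vec2Z !mulN1r vec2D.
apply/(PG_memP _ wP (vec2M_neq0 Upsi w0))/eqP => [[k]|eqw].
  by rewrite scalemxAl vec2Z => /(vec2M_inj Upsi)[-> ->]; ring.
have [w10|w10] := eqVneq w1 0.
  rewrite w10 eqxx /= in w0; exists ((y - a2) / w2); rewrite scalemxAl vec2Z.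
  move/eqP: eqw; rewrite w10 !mulr0 mulf_eq0 (negPf w0) orbF => /eqP->.
  by rewrite divfK.
exists ((x - a1) / w1); rewrite scalemxAl vec2Z divfK //.
by rewrite mulrAC eqw mulfK.
Qed.

Lemma mem_translate_block a1 a2 u x y :
  (vec2 x y *m psi \in translate (vec2 a1 a2 *m psi) (mximage psi (Xblock q m u)))
  = (y == u * x ^+ (q ^ m) + (a2 - u * a1 ^+ (q ^ m))).
Proof.
rewrite in_translate -mulmxBl.
have -> : vec2 x y - vec2 a1 a2 = vec2 (x - a1) (y - a2) :> 'rV[F]_2.
  by rewrite -[- vec2 _ _]scaleN1r vec2Z !mulN1r vec2D.
have F2 := pchar2 q_even card_F.
have qB : (x - a1) ^+ (q ^ m) = x ^+ (q ^ m) - a1 ^+ (q ^ m).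
  by rewrite !(oppr_pchar2 F2) q_even -expnM exprD_2pow.
apply/imsetP/eqP => [[_ /imsetP[s _ ->] /(vec2M_inj Upsi)[xs ys]]|yE].
  have -> : y = (y - a2) + a2 by rewrite subrK.
  by rewrite ys -xs qB; ring.
exists (vec2 (x - a1) (y - a2)) => //; apply/imsetP; exists (x - a1) => //.
by congr (vec2 _ _); rewrite yE qB; ring.
Qed.

Variable D : {set PG F 1}.

Lemma Andre_line_cases l : l \in Andre_lines D (replacement_net q t psi delta m) ->
  [\/ exists c, forall x y, (vec2 x y *m psi \in l) = (x == c),
      exists s k, forall x y, (vec2 x y *m psi \in l) = (y == s * x + k)
    | exists u k, u != 0 /\ forall x y,
        (vec2 x y *m psi \in l) = (y == u * x ^+ (q ^ m) + k)].
Proof.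
case/setUP => /imset2P[a U _ + ->].
  have [a1 [a2 ->]] := vec2_coords a Upsi.
  have [w w0 wU _] := PG_nonzero U; have [w1 [w2 wE]] := vec2_coords w Upsi.
  rewrite wE in w0 wU.
  have w12 : (w1 != 0) || (w2 != 0).
    by apply: contraNT w0; rewrite negb_or !negbK => /andP[/eqP-> /eqP->];
      rewrite vec2_0 mul0mx.
  have [w10|w10] := eqVneq w1 0.
    constructor 1; exists a1 => x y; rewrite (mem_translate_PG _ _ _ _ wU) //.
    by move: w12; rewrite w10 eqxx mulr0 mulf_eq0 subr_eq0 => /negPf->; rewrite orbF.
  constructor 2; exists (w2 / w1), (a2 - a1 * (w2 / w1)) => x y.
  rewrite (mem_translate_PG _ _ _ _ wU) //; apply/eqP/eqP => [E|->]; last by field.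
  apply: (mulIf w10); apply/eqP; rewrite -subr_eq0; apply/eqP.
  transitivity ((y - a2) * w1 - (x - a1) * w2); first by field.
  by rewrite E subrr.
case/imsetP => u; rewrite inE => /andP[u0 _] ->.
have [a1 [a2 ->]] := vec2_coords a Upsi.
constructor 3; exists u, (a2 - u * a1 ^+ (q ^ m)); split=> // x y.
exact: mem_translate_block.
Qed.

Lemma Andre_block u k : u != 0 -> norm q t u = delta ->
  exists2 l, l \in Andre_lines D (replacement_net q t psi delta m) &
    forall x y, (vec2 x y *m psi \in l) = (y == u * x ^+ (q ^ m) + k).
Proof.
move=> u0 ud; exists (translate (vec2 0 k *m psi) (mximage psi (Xblock q m u))).
  apply/setUP; right; apply: imset2_f => //; apply: imset_f.
  by rewrite inE u0 ud eqxx.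
move=> x y; rewrite mem_translate_block expr0n expn_eq0 gtn_eqF ?mulr0 ?subr0 //.
exact: ltnW (ltnW q_ge3).
Qed.

Variables (T : PG F 1) (al ga : F) (K : {set 'rV[F]_2}).
Hypotheses (T_psi : vec2 0 1 *m psi \in PG_set T) (T_notin : T \notin D).
Hypothesis al_neq0 : al != 0.
Hypothesis K_E : forall x y, (vec2 x y *m psi \in K) = (y == al * x ^+ 2 + ga).

(** This is the line [l0] passed to [completion_oval]. The lines through T survive the replacement
    because [T] is not in [D]. *)
Lemma vertical_line :
  exists2 l, l \in Andre_lines D (replacement_net q t psi delta m) &
    forall x y, (vec2 x y *m psi \in l) = (x == 0).
Proof.
exists (translate (vec2 0 0 *m psi) (PG_set T)).
  by apply/setUP; left; apply: imset2_f; rewrite ?inE.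
move=> x y; rewrite (mem_translate_PG _ _ _ _ T_psi) ?oner_neq0 ?orbT //.
by rewrite mulr0 mulr1 subr0.
Qed.

Lemma parabola_point v : v \in K -> exists x, v = vec2 x (al * x ^+ 2 + ga) *m psi.
Proof.
have [x [y ->]] := vec2_coords v Upsi.
by rewrite K_E => /eqP->; exists x.
Qed.

Lemma card_parabola : #|K| = (q ^ t)%N.
Proof.
rewrite -card_F -cardsT -(card_imset (f := fun x => vec2 x (al * x ^+ 2 + ga) *m psi)).
  apply: eq_card => v; apply/idP/imsetP => [/parabola_point[x ->]|[x _ ->]].
    by exists x.
  by rewrite K_E.
by move=> x y /(vec2M_inj Upsi)[].
Qed.

Lemma block_parabola_inter u d d' : (0 < h * m)%N ->
  coprime (h * t) (h * m).-1 -> u != 0 -> d != 0 -> d' != 0 ->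
  al * d ^+ 2 = u * d ^+ (q ^ m) -> al * d' ^+ 2 = u * d' ^+ (q ^ m) -> d = d'.
Proof.
move=> hm0 cop u0 d0 d'0 dE d'E.
have r2 : (d / d') ^+ (q ^ m) = (d / d') ^+ 2.
  apply: (mulfI u0); apply: (mulIf (expf_neq0 2 d'0)); apply: (mulfI al_neq0).
  rewrite !expr_div_n; transitivity (u * d ^+ (q ^ m) * (al * d' ^+ 2) / d' ^+ (q ^ m)).
    by ring.
  rewrite -dE d'E; field.
  by rewrite d'0 expf_neq0.
(* Both sides of [r2] are squares, as [h m > 0], and squaring is injective. *)
have r1 : (d / d') ^+ (2 ^ (h * m).-1) = d / d'.
  apply: (expr_2pow_inj q_even card_F (k := 1)) => /=; rewrite -exprM -expnSr.
  by rewrite prednK // expnM -q_even r2.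
have rF : (d / d') ^+ (2 ^ (h * t)) = d / d'.
  by rewrite expnM -q_even -card_F expf_card.
have ht0 : (0 < h * t)%N.
  by rewrite muln_gt0 (ltn_trans _ t_ge3) // andbT; case: h hm0.
have := exp2_pow_fixed_coprime ht0 cop rF r1.
have dd0 : d / d' != 0 by rewrite mulf_neq0 ?invr_eq0.
rewrite expr2 -[RHS]mulr1 => /(mulfI dd0) /eqP.
by rewrite -(inj_eq (mulIf d'0)) divfK // mul1r => /eqP.
Qed.

Lemma parabola_oval : (0 < h * m)%N -> coprime (h * t) (h * m).-1 ->
  arc_completable_to_oval (Andre_plane D (replacement_net q t psi delta m))
    (q ^ t) [set inl v | v in K].
Proof.
move=> hm0 cop; have [l0 l0B l0E] := vertical_line.
have F2 := pchar2 q_even card_F.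
apply: (completion_oval card_parabola l0B) => [l a b c lB abc|l a b lB l_l0].
  move=> /parabola_point[x Ea] /parabola_point[y Eb] /parabola_point[z Ec].
  have xy : x != y by apply: contraTneq abc => exy; rewrite Ea Eb exy /= inE eqxx.
  have xz : x != z by apply: contraTneq abc => exy; rewrite Ea Ec exy /= !inE eqxx orbT.
  have yz : y != z by apply: contraTneq abc => exy; rewrite Eb Ec exy /= !inE eqxx andbF.
  have [[k E]|[s [k E]]|[u [k [u0 E]]]] := Andre_line_cases lB; rewrite Ea Eb Ec !E.
  - by move=> /eqP xk /eqP yk; rewrite xk yk eqxx in xy.
  (* Two points of the parabola with abscissae [x], [y] on a line of slope [s] satisfy
     [al (x + y) = s]; likewise for [x], [z]. *)
  - move=> /eqP xE /eqP yE /eqP zE; case/eqP: yz.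
    apply: (addrI x); apply: (mulfI al_neq0); rewrite -subr_eq0 in xy.
    rewrite -subr_eq0 in xz.
    transitivity s; [apply: (mulfI xy) | apply: (mulfI xz)].
      transitivity ((al * x ^+ 2 + ga) - (al * y ^+ 2 + ga)); first by ring.
      by rewrite xE yE; ring.
    transitivity ((al * x ^+ 2 + ga) - (al * z ^+ 2 + ga)); last by ring.
    by rewrite xE zE; ring.
  move=> /eqP xE /eqP yE /eqP zE; case/eqP: yz.
  (* Both powers are additive in characteristic 2, so the difference of two abscissae on one block
     is a zero of [al X^2 - u X^(q^m)]. *)
  have eqd v : al * v ^+ 2 + ga = u * v ^+ (q ^ m) + k ->
      al * (x - v) ^+ 2 = u * (x - v) ^+ (q ^ m).
    move=> vE; rewrite (oppr_pchar2 F2) q_even -expnM exprD_2pow //.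
    rewrite (exprD_2pow x v 1 F2) expnM -q_even !mulrDr.
    apply/eqP; rewrite -subr_eq0; apply/eqP.
    transitivity ((al * x ^+ 2 + ga) + (al * v ^+ 2 + ga) - (u * x ^+ (q ^ m) + k)
      - (u * v ^+ (q ^ m) + k) + (k + k) - (ga + ga)); first by ring.
    by rewrite xE vE !(addrr_pchar2 F2); ring.
  rewrite -subr_eq0 in xy; rewrite -subr_eq0 in xz.
  have := block_parabola_inter hm0 cop u0 xy xz (eqd _ yE) (eqd _ zE).
  by move=> /addrI/oppr_inj.
(* A graph [y = g x] meets the line [x = 0] in exactly one point, so it is neither disjoint from it
   nor equal to it. *)
have vert : exists c, forall x y, (vec2 x y *m psi \in l) = (x == c).
  have graph g : (forall x y, (vec2 x y *m psi \in l) = (y == g x)) -> False.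
    move=> lE; case: l_l0 => [ll0|/pred0P/(_ (vec2 0 (g 0) *m psi))]; last first.
      by rewrite /= lE l0E !eqxx.
    have := lE 0 (g 0 + 1); rewrite ll0 l0E eqxx => /esym.
    by rewrite -subr_eq0 addrAC subrr add0r oner_eq0.
  by have [//|[s [k /graph]]|[u [k [_ /graph]]]] := Andre_line_cases lB.
have [k E] := vert.
by move=> /parabola_point[x ->] /parabola_point[y ->]; rewrite !E => /eqP-> /eqP->.
Qed.

(** The offending block meets the parabola at the abscissae [0], [z] and [r z], with [r] other than
    0 and 1 in the subfield of order [2^t]. Since [t] divides [h m - 1], [r^(q^m) = r^2], so [z] and
    [r z] lie on the same block. *)
Lemma parabola_not_arc : delta != 0 -> delta ^+ q = delta -> (0 < h * m)%N ->
  (t %| (h * m).-1)%N ->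
  ~ is_arc (Andre_plane D (replacement_net q t psi delta m))
    [set inl v | v in K].
Proof.
move=> d0 dq hm0 /dvdnP[j hmj].
have Nal0 : norm q t al != 0 by rewrite norm_eq0.
(* The block will have [u = al z^2 / z^(q^m)]. Norms are fixed by the power [q^m], so [u] has the
   norm of [al z], which must be [delta]. *)
have [z zE] : exists z, norm q t z = delta / norm q t al.
  apply: (norm_onto q_ge3 t_ge3 card_F).
    by rewrite mulf_neq0 ?invr_eq0.
  by rewrite exprMn exprVn dq (norm_expq q_ge3 t_ge3 card_F).
have z0 : z != 0 by rewrite -(norm_eq0 q t_ge3) zE mulf_neq0 ?invr_eq0.
have [r [r0 r1 rt]] :=
  exp2_pow_nontrivial q_even card_F (ltnW t_ge3) (dvdn_mull h (dvdnn t)).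
have rQ : r ^+ (q ^ m) = r ^+ 2.
  rewrite q_even -expnM -(prednK hm0) hmj expnS mulnC exprM.
  by rewrite exp2_pow_fixed_mul.
pose u := al * z ^+ 2 / z ^+ (q ^ m).
have u0 : u != 0 by rewrite !mulf_neq0 ?invr_eq0 ?expf_neq0.
have ud : norm q t u = delta.
  rewrite /u !norm_mul norm_inv !norm_exp exp_q_m ?(norm_expq q_ge3 t_ge3 card_F) //.
  rewrite zE; field; by rewrite d0 Nal0.
have uz : u * z ^+ (q ^ m) = al * z ^+ 2 by rewrite divfK // expf_neq0.
have [l lB lE] := Andre_block ga u0 ud.
apply: (completion_not_arc (l := l) (a := vec2 0 (al * 0 ^+ 2 + ga) *m psi)
  (b := vec2 z (al * z ^+ 2 + ga) *m psi)
  (c := vec2 (r * z) (al * (r * z) ^+ 2 + ga) *m psi)); rewrite ?K_E ?lE //.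
- rewrite /= !inE negb_or andbT; apply/andP; split; [apply/andP; split|].
  + by apply/eqP => /(vec2M_inj Upsi)[/esym/eqP]; rewrite (negPf z0).
  + apply/eqP => /(vec2M_inj Upsi)[/esym/eqP].
    by rewrite mulf_eq0 (negPf r0) (negPf z0).
  apply/eqP => /(vec2M_inj Upsi)[/eqP + _].
  rewrite -subr_eq0 -{1}[z]mul1r -mulrBl mulf_eq0 (negPf z0) orbF subr_eq0.
  by rewrite eq_sym (negPf r1).
- by rewrite !expr0n expn_eq0 (gtn_eqF (ltnW (ltnW q_ge3))) !mulr0.
- by rewrite uz.
by rewrite !exprMn rQ [u * (_ * _)]mulrCA uz mulrCA.
Qed.

End AndreLines.

(** * Exchange of the transversal points, and inversion modulo [t] *)

(** Raising [y = u x^(q^m)] to the power [q^(t-m)] and solving for [x] gives [x = u' y^(q^(t-m))],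
    where [u'] is the inverse of [u^(q^(t-m))] and has norm [delta^-1]. *)
Lemma replacement_net_swap (F : finFieldType) (q t m : nat) (delta : F)
  (phi psi : 'M[F]_2) :
  #|F| = (q ^ t)%N -> (m <= t)%N -> delta ^+ q = delta ->
  (forall x y, vec2 x y *m phi = vec2 y x *m psi) ->
  replacement_net q t phi delta m = replacement_net q t psi delta^-1 (t - m).
Proof.
move=> card_F.
(* Replacing [m] by [t - m] and [delta] by its inverse is an involution, so one inclusion yields the
   other. *)
suff sub m' delta' (phi' psi' : 'M[F]_2) : (m' <= t)%N -> delta' ^+ q = delta' ->
    (forall x y, vec2 x y *m phi' = vec2 y x *m psi') ->
    replacement_net q t phi' delta' m'
      \subset replacement_net q t psi' delta'^-1 (t - m').
  move=> le_mt dq swap; apply/eqP; rewrite eqEsubset sub //=.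
  have := sub (t - m)%N delta^-1 psi phi; rewrite leq_subr subKn // invrK.
  by apply; rewrite // exprVn dq.
move: m' delta' phi' psi' => {}m {}delta {}phi {}psi le_mt dq swap.
have expF (x : F) : x ^+ (q ^ t) = x by rewrite -card_F expf_card.
apply/subsetP => _ /imsetP[u /[!inE] /andP[u0 /eqP ud] ->].
apply/imsetP; exists (u ^+ (q ^ (t - m)))^-1.
  rewrite inE invr_eq0 expf_neq0 //= norm_inv norm_exp ud exp_q_m //.
apply/setP => v; apply/imsetP/imsetP => -[_ /imsetP[s _ ->] ->].
  exists (vec2 (s ^+ (q ^ m) * u) s); last exact: swap.
  apply/imsetP; exists (s ^+ (q ^ m) * u) => //.
  by rewrite exprMn mulfK ?expf_neq0 // -exprM -expnD subnKC // expF.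
exists (vec2 (s ^+ (q ^ (t - m)) * (u ^+ (q ^ (t - m)))^-1) s); last by rewrite swap.
apply/imsetP; exists (s ^+ (q ^ (t - m)) * (u ^+ (q ^ (t - m)))^-1) => //.
by rewrite exprMn exprVn -!exprM -!expnD subnK // !expF divfK //.
Qed.

(** For positive [m], [t] divides [h m - 1] exactly when [m] is an inverse of [h] modulo [t]. A
    Bezout coefficient reduced modulo [t] supplies it. *)
Lemma inverse_mod_prime (h t : nat) : prime t -> h <> 0 %[mod t] ->
  exists n, [/\ (1 <= n <= t - 1)%N, (t %| (h * n).-1)%N &
    forall m, (1 <= m <= t - 1)%N -> (t %| (h * m).-1)%N -> m = n].
Proof.
move=> t_prime; rewrite mod0n => /eqP; rewrite -/(t %| h)%N => th.
have h0 : (0 < h)%N by rewrite lt0n; apply: contraNneq th => ->; apply: dvdn0.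
have t1 := prime_gt1 t_prime.
have eqm m : (0 < m)%N -> (t %| (h * m).-1)%N = (h * m == 1 %[mod t]).
  move=> m0; rewrite eqn_mod_dvd ?subn1 // muln_gt0 h0; exact: m0.
have cop : coprime t h by rewrite prime_coprime.
have uniqm m n : (1 <= m <= t - 1)%N -> (1 <= n <= t - 1)%N -> (n <= m)%N ->
    h * m = h * n %[mod t] -> m = n.
  move=> mt nt nm /eqP; rewrite eqn_mod_dvd ?leq_mul // -mulnBr Gauss_dvdr //.
  move=> /dvdn_leq; move: mt nt nm; clear; lia.
case: (egcdnP t h0) => u v uv _; rewrite gcdnC (eqP cop) in uv.
have hu : h * (u %% t) = 1 %[mod t] by rewrite modnMmr mulnC uv modnMDl.
have u0 : (0 < u %% t)%N.
  rewrite lt0n; apply/eqP => u0; move: hu; rewrite u0 muln0 mod0n modn_small //.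
have ut : (1 <= u %% t <= t - 1)%N.
  by rewrite u0 /= leq_subRL ?add1n ?ltn_mod ltnW.
exists (u %% t)%N; split=> //; first by rewrite eqm //; apply/eqP.
move=> m mt; rewrite eqm; last by case/andP: mt.
rewrite -hu => /eqP hm; case: (leqP (u %% t) m) => [|/ltnW] le.
  exact: uniqm.
by apply/esym/uniqm.
Qed.

Theorem theorem14 (q h t : nat) (F : finFieldType)
  (q_even : q = (2 ^ h)%N) (t_prime : prime t) (t_ge3 : (3 <= t)%N)
  (q_ge_t : (t <= q)%N) (card_F : #|F| = (q ^ t)%N)
  (C : {set PG F 2}) (T N : PG F 1)
  (C_conic : is_conic C)
  (N_nucleus : is_nucleus C (infty N))
  (T_tangent : tangent_at C (line_at_infinity F) (infty T))
  (D : {set PG F 1})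
  (D_Andre : is_Andre_set q t T N D)
  (delta : F) (delta_neq0 : delta != 0) (delta_Fq : delta ^+ q = delta)
  (phi : 'M[F]_2) (phi_unit : phi \in unitmx)
  (sigma : {perm PG F 1}) (phi_sigma : induces phi sigma)
  (sigma_D : [set sigma P | P in std_Andre_set q t delta] = D) :
  let plane_ (m : nat) := Andre_plane D (replacement_net q t phi delta m) in
  (h = 0 %[mod t] ->
     forall m : nat, (1 <= m <= t - 1)%N ->
       arc_completable_to_oval (plane_ m) (q ^ t) (Andre_image C))
  /\
  (h <> 0 %[mod t] ->
     exists n : nat,
       unique (fun k : nat =>
         (1 <= k <= t - 1)%N /\ ~ is_arc (plane_ k) (Andre_image C)) n
       /\ forall m : nat, (1 <= m <= t - 1)%N -> m <> n ->
            arc_completable_to_oval (plane_ m) (q ^ t) (Andre_image C)).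
Proof.
move=> plane_.
have q_ge3 : (3 <= q)%N := leq_trans t_ge3 q_ge_t.
have h0 : (0 < h)%N by case: h q_even q_ge3 => // ->.
have T_notin := Andre_set_transversal_notin t_ge3 D_Andre.
(* Stated for any basis along (N, T) and any [delta'], so that it also applies after the two
   coordinates are exchanged. *)
have good psi m : psi \in unitmx -> vec2 1 0 *m psi \in PG_set N ->
    vec2 0 1 *m psi \in PG_set T -> forall delta' : F,
    delta' != 0 -> delta' ^+ q = delta' -> (0 < m)%N ->
    let Pi := Andre_plane D (replacement_net q t psi delta' m) in
    if (t %| (h * m).-1)%N then ~ is_arc Pi (Andre_image C)
    else arc_completable_to_oval Pi (q ^ t) (Andre_image C).
  move=> Upsi N1 T1 delta' d0 dq m0 Pi.
  have [al [ga [al0 KE]]] :=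
    affine_conic_parabola Upsi C_conic N_nucleus T_tangent N1 T1.
  have hm0 : (0 < h * m)%N by rewrite muln_gt0 h0.
  case: ifPn => [t_dvd|t_ndvd].
    exact: (parabola_not_arc q_even q_ge3 t_ge3 card_F Upsi al0 KE).
  apply: (parabola_oval q_even t_ge3 card_F delta' Upsi T1 T_notin al0 KE hm0).
  (* Since [h] divides [h m], it is prime to [h m - 1]; only the factor [t] matters. *)
  rewrite coprimeMl (prime_coprime _ t_prime) t_ndvd andbT.
  by rewrite (@coprime_dvdl _ (h * m)) ?dvdn_mulr // coprimenP.
(* [f m] is the index of the [m]-th net with respect to the basis (N, T). *)
have [f [f_range fK fP]] : exists f, [/\
    (forall m, (1 <= m <= t - 1)%N -> (1 <= f m <= t - 1)%N),
    (forall m, (1 <= m <= t - 1)%N -> f (f m) = m) &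
    forall m, (1 <= m <= t - 1)%N ->
      if (t %| (h * f m).-1)%N then ~ is_arc (plane_ m) (Andre_image C)
      else arc_completable_to_oval (plane_ m) (q ^ t) (Andre_image C)].
  have [[N1 T1]|[T1 N1]] := Andre_set_transversals q_even q_ge3 t_ge3 card_F D_Andre
    delta_neq0 delta_Fq phi_unit phi_sigma sigma_D.
    by exists id; split=> // m /andP[m0 _]; apply: good.
  (* Here [phi] sends [(1, 0)] to T; swapping its rows restores the order (N, T), at the price of
     replacing [m] by [t - m]. *)
  pose S : 'M[F]_2 := perm_mx (tperm 0 1).
  have swap x y : vec2 x y *m phi = vec2 y x *m (S *m phi).
    rewrite mulmxA -xcolE; congr (_ *m _); apply/rowP => j; rewrite !mxE.
    have /orP[/eqP->|/eqP->] : (j == 0) || (j == 1) by case: j => [[|[|]]].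
      by rewrite tpermL.
    by rewrite tpermR.
  have swap' x y : vec2 x y *m (S *m phi) = vec2 y x *m phi by rewrite swap.
  exists (fun m => t - m)%N; split; [lia | lia|].
  move=> m mt; rewrite /plane_ (replacement_net_swap card_F _ delta_Fq swap); last by lia.
  apply: good; rewrite ?swap' ?invr_eq0 ?exprVn ?delta_Fq //; last by lia.
  by rewrite unitmx_mul phi_unit andbT unitmx_perm.
have arcP m : (1 <= m <= t - 1)%N -> ~ is_arc (plane_ m) (Andre_image C) ->
    (t %| (h * f m).-1)%N.
  by move=> mt narc; have := fP m mt; case: ifP => // _ [].
split=> [|/(inverse_mod_prime t_prime)[n [nt tn n_uniq]]].
  rewrite mod0n => /eqP; rewrite -/(t %| h)%N => th m mt.
  have := fP m mt; case: ifPn => // tf.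
  have /andP[fm0 _] := f_range m mt.
  (* Otherwise [t] would divide both [h * f m] and its predecessor, hence 1. *)
  have := dvdn_sub (dvdn_mulr (f m) th) tf.
  rewrite -[X in (X - _)%N]prednK ?muln_gt0 ?h0 //.
  by rewrite subSnn dvdn1 => /eqP t1; rewrite t1 in t_ge3.
(* [n] inverts [h] modulo [t] and [f] is an involution, so [f n] is the index whose net has index
   [n] in the basis (N, T). *)
exists (f n); split=> [|m mt mn].
  split=> [|m [mt /(arcP m mt) tm]]; last by rewrite -(n_uniq _ (f_range _ mt) tm) fK.
  split; first exact: f_range.
  by have := fP _ (f_range _ nt); rewrite fK // tn.
have := fP m mt; case: ifP => // tm; case: mn.
by rewrite -(n_uniq _ (f_range _ mt) tm) fK.
Qed.
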